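(* Let $h>0$ and let $A_h=\frac{1}{h^2}[-1\ \ 2\ \ -1]$ be the three-point discrete Laplacian on the infinite one-dimensional grid $h\mathbb{Z}$. The element-wise additive Vanka operator $M_e$ for $A_h$ is given by the stencil $$M_e=\frac{h^2}{6}\,[\,1\ \ 4\ \ 1\,].$$ Consequently $M_e=h\,M_{fe}$, where $M_{fe}=\frac{h}{6}[\,1\ \ 4\ \ 1\,]$ is the mass stencil of linear finite elements in one dimension.
   Context: Grid functions are functions $u:h\mathbb{Z}\to\mathbb{C}$. A stencil $[s_{k}]_{k}$ (finitely many nonzero entries, the centre entry being $k=0$) defines the operator $(Su)(x)=\sum_k s_k\,u(x+kh)$. Additive Vanka operator: given a family of finite subsets (patches) $\Upsilon_i$ of the grid whose union is the whole grid, let $V_i$ be the restriction of a grid function to $\Upsilon_i$, $V_i^T$ its transpose (extension by zero), and $A_i=V_iA_hV_i^T$. Then $M=\sum_i V_i^T W_i A_i^{-1}V_i$, where $W_i$ is the diagonal matrix whose entry at each grid point of $\Upsilon_i$ is the reciprocal of the number of patches containing that grid point. The element-wise Vanka operator $M_e$ in one dimension uses the patches $\{x_j,x_{j+1}\}$, $x_j=jh$, $j\in\mathbb{Z}$ (so $A_i=\frac{1}{h^2}\begin{pmatrix}2&-1\\-1&2\end{pmatrix}$ and $W_i=\frac12 I$). *)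

(* Defs.v *)
From HB Require Import structures.
From mathcomp Require Import all_boot all_order all_algebra.
From mathcomp Require Import finmap complex.
From mathcomp Require Import all_classical all_reals all_analysis.

Set Implicit Arguments.
Unset Strict Implicit.
Unset Printing Implicit Defensive.

Import Order.TTheory GRing.Theory Num.Theory.

Local Open Scope ring_scope.
Local Open Scope complex_scope.

(* A grid function on hZ is indexed by j : int, u j being its value at the    *)
(* point jh. The mesh size h then only enters through stencil entries.        *)
Definition gridfun (R : realType) := int -> R[i].

Definition stencil (R : realType) := {fsfun int -> R[i] with 0}.

Definition stencil_op (R : realType) (s : stencil R) (u : gridfun R) :
    gridfun R :=
  fun j => \sum_(k <- finsupp s) s k * u (j + k).

(* c [a  b  d], centred at b. *)
Definition stencil3 (R : realType) (c a b d : R) : stencil R :=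
  [fsfun k in [fset -1; 0; 1]%fset =>
     (c * (if k == -1 then a else if k == 0 then b else d))%:C].

Section Vanka.
Variable R : realType.
Local Notation C := R[i].

(* The p-th point of a patch, in the enumeration order of the finite set P;   *)
(* the default value 0 is never reached, since p < #|` P|.                    *)
Definition patch_pt (P : {fset int}) (p : 'I_#|` P|) : int :=
  nth 0 (enum_fset P) p.

(* V_i *)
Definition patch_restr (P : {fset int}) (u : gridfun R) : 'cV[C]_#|` P| :=
  \col_p u (patch_pt p).

(* V_i^T *)
Definition patch_ext (P : {fset int}) (v : 'cV[C]_#|` P|) : gridfun R :=
  fun j => \sum_(p < #|` P|) if patch_pt p == j then v p 0 else 0.

(* A_i = V_i A V_i^T, whose q-th column is the image of the q-th unit vector. *)
Definition patch_mx (A : gridfun R -> gridfun R) (P : {fset int}) :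
    'M[C]_#|` P| :=
  \matrix_(p, q) patch_restr P (A (patch_ext (delta_mx q 0))) p 0.

(* The number of patches of the family containing j (meaningful for locally   *)
(* finite families).                                                          *)
Definition patch_count (I : choiceType) (Y : I -> {fset int}) (j : int) : nat :=
  #|` fset_set [set i : I | j \in Y i]%classic|.

(* W_i *)
Definition patch_weight (I : choiceType) (Y : I -> {fset int}) (i : I) :
    'M[C]_#|` Y i| :=
  diag_mx (\row_p ((patch_count Y (patch_pt p))%:R^-1)).

(* M = sum_i V_i^T W_i A_i^-1 V_i. At each grid point only the patches        *)
(* containing it contribute, so for a locally finite family the sum below has *)
(* finite support.                                                            *)
Definition vanka (I : choiceType) (Y : I -> {fset int})
    (A : gridfun R -> gridfun R) (u : gridfun R) : gridfun R :=
  fun j => \sum_(i \in [set: I]%classic)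
    patch_ext (patch_weight Y i *m invmx (patch_mx A (Y i))
                 *m patch_restr (Y i) u) j.

End Vanka.

Definition elem_patch (j : int) : {fset int} := [fset j; (j + 1)%R]%fset.

Definition laplacian (R : realType) (h : R) : gridfun R -> gridfun R :=
  stencil_op (stencil3 (h ^- 2) (-1) 2 (-1)).

Definition elem_vanka (R : realType) (h : R) : gridfun R -> gridfun R :=
  vanka elem_patch (laplacian h).

(* The nodal (hat) basis function of continuous piecewise linear finite       *)
(* elements attached to the node jh.                                          *)
Definition hat (R : realType) (h : R) (j : int) (x : R) : R :=
  Num.max 0 (1 - `|x / h - j%:~R|).

Definition mass_entry (R : realType) (h : R) (i j : int) : R :=
  Rintegral (@lebesgue_measure R) setT (fun x => hat h i x * hat h j x).

(* s is the mass stencil of linear finite elements: applying s amounts to     *)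
(* applying the bi-infinite mass matrix.                                      *)
Definition is_mass_stencil (R : realType) (h : R) (s : stencil R) : Prop :=
  forall j k : int, s k = (mass_entry h j (j + k))%:C.

(* Main.v *)
(* Each grid point j lies in exactly the two patches {j-1, j} and {j, j+1}.   *)
(* On a patch {m, m+1} the weighted inverse W_i A_i^-1 is                     *)
(* (h^2/6) [2 1; 1 2], so at j the patch contributes                          *)
(* (h^2/6) (u j + (u m + u (m+1))); adding the two contributions gives        *)
(* (h^2/6) [1 4 1]. On a single cell, with t in [0, 1] the local coordinate,  *)
(* the hat functions are t and 1 - t, and the integrals of t^2, (1-t)^2 and   *)
(* t(1-t) over the cell are h/3, h/3 and h/6.                                 *)

Require Import Defs.
From HB Require Import structures.
From mathcomp Require Import all_boot all_order all_algebra.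
From mathcomp Require Import finmap complex.
From mathcomp Require Import all_classical all_reals all_analysis.
From mathcomp Require Import ring lra zify.

Set Implicit Arguments.
Unset Strict Implicit.
Unset Printing Implicit Defensive.

Import Order.TTheory GRing.Theory Num.Theory.
Import numFieldNormedType.Exports.

Local Open Scope ring_scope.
Local Open Scope complex_scope.

(** The local inverse is $\frac{h^2}{3}$ times [2 1; 1 2], and the weight halves it. From each of
    its two patches a point thus receives $\frac{h^2}{6}$ times twice its own value plus its
    neighbour's ([vanka_elem_patch]); the two contributions add up to the stencil in [elem_vankaE].
    For the mass matrix, hat functions are affine on every cell, so each entry reduces to integrals
    of quadratic polynomials over a reference cell ([Rintegral_cell]): $h/6$ for adjacent nodes,
    $2h/3$ on the diagonal, $0$ beyond. The factor $h$ is then read off the two explicit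
    stencils. *)

Lemma stencil_op3 (R : realType) (c a b d : R) (u : gridfun R) (j : int) :
  stencil_op (stencil3 c a b d) u j =
  (c * a)%:C * u (j - 1) + (c * b)%:C * u j + (c * d)%:C * u (j + 1).
Proof.
rewrite /stencil_op.
rewrite (@big_fset_incl _ _ _ _ _ [fset -1; 0; 1]%fset) /=; last 2 first.
- by apply/fsubsetP => k; rewrite mem_finsupp fsfunE; case: ifP => // _; rewrite eqxx.
- by move=> k _; rewrite memNfinsupp => /eqP ->; rewrite mul0r.
rewrite -fsetUA big_fsetU1 ?inE//= big_fsetU1 ?inE//= big_seq_fset1.
by rewrite /stencil3 !fsfunE !inE /= addr0 addrA.
Qed.

(** * Patches and the element-wise Vanka operator *)

Lemma big_patch_pt (V : nmodType) (P : {fset int}) (f : int -> V) :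
  \sum_(p < #|` P|) f (patch_pt p) = \sum_(x <- P) f x.
Proof. by rewrite [RHS](big_nth 0) big_mkord. Qed.

Lemma patch_pt_in (P : {fset int}) (p : 'I_#|` P|) : patch_pt p \in P.
Proof. exact: mem_nth. Qed.

Lemma patch_pt_inj (P : {fset int}) : injective (@patch_pt P).
Proof.
by move=> p q /eqP; rewrite nth_uniq ?fset_uniq// => /eqP /val_inj.
Qed.

Lemma patch_ext_col (R : realType) (P : {fset int}) (g : gridfun R) (j : int) :
  patch_ext (\col_(p < #|` P|) g (patch_pt p)) j = if j \in P then g j else 0.
Proof.
rewrite /patch_ext; under eq_bigr do rewrite mxE.
rewrite (big_patch_pt P (fun x => if x == j then g x else 0)); case: ifPn => jP.
  rewrite (big_fsetD1 j)//= eqxx big_seq big1 ?addr0// => x.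
  by rewrite !inE => /andP[/negPf ->].
by rewrite big_seq big1// => x xP; case: eqP => // xj; rewrite -xj xP in jP.
Qed.

Lemma patch_ext_delta (R : realType) (P : {fset int}) (q : 'I_#|` P|) (j : int) :
  patch_ext (delta_mx q 0 : 'cV[R[i]]_#|` P|) j = (patch_pt q == j)%:R.
Proof.
rewrite /patch_ext (bigD1 q)//= mxE !eqxx big1 ?addr0.
  by case: eqP.
by move=> r rq; rewrite mxE (negPf rq) if_same.
Qed.

(** The entries depend only on whether [p == q], so the order in which the two points are enumerated
    never matters. *)
Lemma patch_mx_elem (R : realType) (h : R) (m : int)
    (p q : 'I_#|` elem_patch m|) :
  patch_mx (laplacian h) (elem_patch m) p q =
  (h ^- 2)%:C * (if p == q then 2 else -1).
Proof.
rewrite !mxE /laplacian stencil_op3 !patch_ext_delta -(inj_eq (@patch_pt_inj _)).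
have := patch_pt_in p; have := patch_pt_in q; rewrite !inE.
rewrite !rmorphM rmorphN rmorph1 rmorph_nat.
have mm : (m == m + 1) = false by lia.
have mm' : (m + 1 == m) = false by lia.
have mp : (m == m + 1 + 1) = false by lia.
have mn : (m + 1 == m - 1) = false by lia.
have m0 : (m == m - 1) = false by lia.
have m1 : (m + 1 == m + 1 + 1) = false by lia.
by case/orP => /eqP ->; case/orP => /eqP ->;
  rewrite ?addrK ?eqxx ?mm ?mm' ?mp ?mn ?m0 ?m1 /=; ring.
Qed.

(** The size is a variable [n] because the cardinality of a patch equals 2 only propositionally. *)
Lemma invmx_pair (F : numFieldType) (c : F) n : c != 0 -> n = 2 ->
  invmx (\matrix_(p < n, q < n) (c * (if p == q then 2 else -1))) =
  \matrix_(p < n, q < n) (c^-1 / 3 * (if p == q then 2 else 1)).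
Proof.
move=> c0 ->; set A := (X in invmx X); set B := RHS.
(* For square matrices a one-sided inverse is enough. *)
suff AB : A *m B = 1%:M.
  have [uA _] := mulmx1_unit AB.
  by rewrite -[LHS]mulmx1 -AB mulKmx.
apply/matrixP => i j; rewrite !mxE !big_ord_recl big_ord0 !mxE.
by case: i => [[|[|//]]] ?; case: j => [[|[|//]]] ?; rewrite /= ?eqxx/=; field.
Qed.

Lemma patch_count_elem (j : int) : patch_count elem_patch j = 2.
Proof.
rewrite /patch_count.
have -> : [set i : int | j \in elem_patch i]%classic = [set j - 1; j]%classic.
  apply/seteqP; split => i; rewrite /= !inE.
    by case/orP => /eqP ->; [right|left; rewrite addrK].
  by case=> ->; rewrite ?subrK eqxx ?orbT.
rewrite fset_setU// !fset_set1 cardfs2.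
by have -> : j - 1 != j by lia.
Qed.

(** Writing the local sum as [u j] plus the total over the patch gives one formula for both
    endpoints. The 6 is the 3 of the inverse times the patch count 2. *)
Lemma vanka_elem_patch (R : realType) (h : R) (u : gridfun R) (m j : int) :
  h != 0 ->
  patch_ext (patch_weight R elem_patch m
     *m invmx (patch_mx (laplacian h) (elem_patch m))
     *m patch_restr (elem_patch m) u) j =
  if j \in elem_patch m
  then (h ^+ 2 / 6)%:C * (u j + (u m + u (m + 1))) else 0.
Proof.
move=> h0.
have h2 : (h ^- 2)%:C != 0 by rewrite fmorph_eq0 invr_eq0 expf_eq0.
have cP : #|` elem_patch m| = 2 by rewrite cardfs2; have -> : m != m + 1 by lia.
have -> : patch_mx (laplacian h) (elem_patch m) =
    \matrix_(p, q) ((h ^- 2)%:C * (if p == q then 2 else -1)).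
  by apply/matrixP => p q; rewrite patch_mx_elem [RHS]mxE.
rewrite (invmx_pair h2 cP).
rewrite -(patch_ext_col _ (fun j => (h ^+ 2 / 6)%:C * (u j + (u m + u (m + 1))))).
congr patch_ext.
apply/colP => p; rewrite -mulmxA mul_diag_mx !mxE patch_count_elem.
(* [2 1; 1 2] is the identity plus the all-ones matrix. *)
rewrite (eq_bigr (fun q => (h ^- 2)%:C^-1 / 3 *
   ((if q == p then u (patch_pt q) else 0) + u (patch_pt q)))); last first.
  move=> q _; rewrite !mxE eq_sym; case: eqP => _; ring.
rewrite -mulr_sumr big_split/= -big_mkcond/= big_pred1_eq.
rewrite (big_patch_pt (elem_patch m) u).
rewrite big_fsetU1 ?big_seq_fset1 ?inE; last lia.
have -> : ((h ^- 2)%:C)^-1 = (h ^+ 2)%:C by rewrite -fmorphV invrK.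
have -> : (h ^+ 2 / 6)%:C = (h ^+ 2)%:C / 6 by rewrite rmorphM fmorphV rmorph_nat.
by rewrite /=; field.
Qed.

Lemma elem_vankaE (R : realType) (h : R) : h != 0 ->
  elem_vanka h = stencil_op (stencil3 (h ^+ 2 / 6) 1 4 1).
Proof.
move=> h0; apply/funext => u; apply/funext => j.
rewrite stencil_op3 /elem_vanka /vanka.
under eq_fsbigr do rewrite vanka_elem_patch//.
rewrite (@fsbigTE _ _ _ _ [fset j - 1; j]%fset); last first.
  move=> i; rewrite !inE => /norP[ij1 ij]; case: ifP => //.
  by case/orP => /eqP ji; [rewrite ji eqxx in ij|rewrite ji addrK eqxx in ij1].
rewrite big_fsetU1 ?big_seq_fset1 ?inE; last lia.
rewrite /= subrK !eqxx orbT/= !rmorphM fmorphV rmorph1 !rmorph_nat.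
by field.
Qed.

(** * The mass matrix of the hat functions *)

Lemma Rintegral_supp (R : realType) (D : set R) (f : R -> R) :
  (forall x, ~ D x -> f x = 0) ->
  Rintegral (@lebesgue_measure R) setT f = Rintegral lebesgue_measure D f.
Proof.
move=> f0; rewrite [RHS]Rintegral_mkcond; congr Rintegral.
apply/funext => x; rewrite patchE; case: ifPn => // /negP xD.
by apply: f0 => Dx; apply: xD; rewrite inE.
Qed.

Lemma Rintegral_FTC_poly (R : realType) (f : R -> R) (p : {poly R}) (a b : R) :
  a < b -> continuous f -> {in `]a, b[, f =1 horner p^`()} ->
  Rintegral (@lebesgue_measure R) `[a, b]%classic f = p.[b] - p.[a].
Proof.
move=> ab cf fp.
rewrite /Rintegral (@continuous_FTC2 _ f (horner p))//.
- exact: continuous_subspaceT.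
- split.
  + by move=> x _; exact: derivable_horner.
  + by apply: cvg_at_right_filter; exact: continuous_horner.
  + by apply: cvg_at_left_filter; exact: continuous_horner.
- by move=> x xab; rewrite -derivE fp.
Qed.

Section Mass.
Variables (R : realType) (h : R).
Hypothesis h_gt0 : 0 < h.

Local Notation mu := (@lebesgue_measure R).

(** Substitution $t = x/h - m$: a primitive of [f] on the cell is $h\,G(t)$, the $h$ cancelling the
    inner derivative $1/h$. *)
Lemma Rintegral_cell (f : R -> R) (G : {poly R}) (m : int) :
  continuous f ->
  (forall x, 0 < x / h - m%:~R < 1 -> f x = G^`().[x / h - m%:~R]) ->
  Rintegral mu `[m%:~R * h, (m%:~R + 1) * h]%classic f = h * (G.[1] - G.[0]).
Proof.
move=> cf fG; have h0 : h != 0 by rewrite gt_eqF.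
pose q : {poly R} := h^-1 *: 'X - m%:~R%:P.
have qE x : q.[x] = x / h - m%:~R by rewrite /q !hornerE mulrC.
rewrite (@Rintegral_FTC_poly _ f (h *: (G \Po q)))//.
- rewrite !hornerZ !horner_comp !qE -mulrBr; congr (h * (G.[_] - G.[_])); by field.
- by rewrite ltr_pM2r// ltrDl.
- move=> x; rewrite in_itv/= => /andP[ax xb].
  rewrite fG; last first.
    by rewrite subr_gt0 ltrBlDl ltr_pdivlMr// ltr_pdivrMr// ax xb.
  rewrite derivZ deriv_comp hornerZ hornerM horner_comp qE.
  rewrite /q derivB derivZ derivX derivC subr0 alg_polyC hornerC.
  by field.
Qed.

Lemma continuous_hat (j : int) : continuous (hat h j).
Proof.
move=> x.
have cg : {for x, continuous ((fun x => 1 - `|x / h - j%:~R|) : R -> R^o)}.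
  apply: cvgB; first exact: cvg_cst.
  apply: cvg_norm; apply: cvgB; last exact: cvg_cst.
  by apply: cvgM; [exact: cvg_id|exact: cvg_cst].
exact: (continuous_max (@cst_continuous R R^o 0 x) cg).
Qed.

Lemma continuous_hatM (i j : int) : continuous (fun x => hat h i x * hat h j x).
Proof. by move=> x; apply: cvgM; exact: continuous_hat. Qed.

Lemma hat_out (j : int) (x : R) : 1 <= `|x / h - j%:~R| -> hat h j x = 0.
Proof. by move=> ?; apply/max_idPl; rewrite subr_le0. Qed.

Lemma hat_in (j : int) (x : R) :
  `|x / h - j%:~R| <= 1 -> hat h j x = 1 - `|x / h - j%:~R|.
Proof. by move=> ?; apply/max_idPr; rewrite subr_ge0. Qed.

Lemma mass_entryC (i j : int) : mass_entry h i j = mass_entry h j i.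
Proof. by congr Rintegral; apply/funext => x; rewrite mulrC. Qed.

(** The node $i+1$ separates the supports: [hat h j] vanishes to its left, [hat h i] to its
    right. *)
Lemma mass_entry_far (i j : int) : i + 1 < j -> mass_entry h i j = 0.
Proof.
move=> ij; rewrite /mass_entry (@Rintegral_supp _ set0) ?Rintegral_set0// => x _.
have {ij} : (i + 2)%:~R <= j%:~R :> R by rewrite ler_int; lia.
rewrite intrD => ij.
have [xi|xi] := leP (x / h) (i%:~R + 1).
  by rewrite (hat_out (j := j)) ?mulr0// ler_normr; apply/orP; right; lra.
by rewrite hat_out ?mul0r// ler_normr; apply/orP; left; lra.
Qed.

Lemma mass_entry_next (m : int) : mass_entry h m (m + 1) = h / 6.
Proof.
have h0 : h != 0 by rewrite gt_eqF.
pose f x := hat h m x * hat h (m + 1) x.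
rewrite /mass_entry -/f (@Rintegral_supp _ `[m%:~R * h, (m%:~R + 1) * h]%classic).
  (* On this cell the product is $(1-t)t$, with primitive $t^2/2 - t^3/3$. *)
  rewrite (@Rintegral_cell f (2^-1 *: 'X^2 - 3^-1 *: 'X^3)).
  - rewrite !hornerE /=; by field.
  - exact: continuous_hatM.
  - move=> x /andP[x0 x1]; rewrite /f !hat_in ?intrD ?ler_norml; try lra.
    rewrite ger0_norm ?ler0_norm; try lra.
    rewrite derivB !derivZ !derivXn !hornerE /= ?hornerE; by field.
move=> x; rewrite /= in_itv/= => /negP; rewrite negb_and -!ltNge.
rewrite -(ltr_pdivrMr _ _ h_gt0) -(ltr_pdivlMr _ _ h_gt0).
case/orP => ?; rewrite /f.
  by rewrite (hat_out (j := m + 1)) ?mulr0// ler_normr intrD; apply/orP; right; lra.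
by rewrite hat_out ?mul0r// ler_normr; apply/orP; left; lra.
Qed.

Lemma mass_entry_diag (m : int) : mass_entry h m m = h / 6 * 4.
Proof.
have h0 : h != 0 by rewrite gt_eqF.
pose f x := hat h m x * hat h m x.
have cf : continuous f by exact: continuous_hatM.
have intf a b : mu.-integrable `[a, b]%classic (EFin \o f).
  apply: continuous_compact_integrable; first exact: segment_compact.
  exact: continuous_subspaceT.
pose a : R := (m - 1)%:~R * h; pose b : R := m%:~R * h; pose c : R := (m%:~R + 1) * h.
have ab : a <= b by rewrite ler_pM2r// ler_int; lia.
have bc : b <= c by rewrite ler_pM2r// lerDl.
rewrite /mass_entry -/f (@Rintegral_supp _ `[a, c]%classic); last first.
  move=> x; rewrite /= in_itv/= => /negP; rewrite negb_and -!ltNge.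
  rewrite -(ltr_pdivrMr _ _ h_gt0) -(ltr_pdivlMr _ _ h_gt0) intrB => xac.
  by rewrite /f hat_out ?mul0r// ler_normr; case/orP: xac => ?; apply/orP; [right|left]; lra.
(* The support is split at the node, where the hat has its kink. *)
have := @Rintegral_itvB _ f (BLeft a) (BRight c) b (intf a c).
rewrite !bnd_simp => /(_ ab bc)/eqP; rewrite subr_eq => /eqP ->.
rewrite Rintegral_itv_obnd_cbnd; last first.
  by apply: integrableS (intf b c) => //; exact: subset_itv_oc_cc.
(* On the right cell the hat is $1-t$; on the left one, below, it is $t$. Each contributes $h/3$. *)
rewrite /b /c (@Rintegral_cell _ (3^-1 *: ('X - 1) ^+ 3))//; last first.
  move=> x /andP[x0 x1]; rewrite /f !hat_in ?ler_norml; try lra.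
  rewrite ger0_norm; last lra.
  rewrite derivZ deriv_exp !hornerE /= derivB derivX derivC !hornerE; by field.
(* This puts the left interval in the form of the cell based at $m-1$. *)
have -> : (m%:~R : R) = (m - 1)%:~R + 1 by rewrite intrB; ring.
rewrite /a (@Rintegral_cell _ (3^-1 *: 'X^3))//; last first.
  move=> x; rewrite intrB => /andP[x0 x1]; rewrite /f !hat_in ?ler_norml; try lra.
  rewrite ler0_norm; last lra.
  rewrite derivZ derivXn !hornerE /= ?hornerE; by field.
rewrite !hornerE /=; by field.
Qed.

(** The entries depend only on the distance between nodes, so symmetry reduces negative offsets to
    positive ones. *)
Lemma is_mass_stencil_fe : is_mass_stencil h (stencil3 (h / 6) 1 4 1).
Proof.
move=> j k; rewrite /stencil3 fsfunE !inE.
have [->|kN1] := eqVneq k (-1).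
  by rewrite /= mulr1 -{1}(subrK 1 j) mass_entryC mass_entry_next.
have [->|k0] := eqVneq k 0; first by rewrite addr0 mass_entry_diag.
have [->|k1] := eqVneq k 1; first by rewrite /= mulr1 mass_entry_next.
rewrite /=; have [k_gt0|k_le0] := ltP 0 k; last rewrite mass_entryC;
  by rewrite mass_entry_far//; lia.
Qed.

End Mass.

Theorem mainTheorem7 (R : realType) (h : R) (h_gt0 : 0 < h) :
  let M_fe := stencil3 (h / 6) 1 4 1 in
  [/\ elem_vanka h = stencil_op (stencil3 (h ^+ 2 / 6) 1 4 1),
      is_mass_stencil h M_fe
    & forall (u : gridfun R) (j : int),
        elem_vanka h u j = h%:C * stencil_op M_fe u j].
Proof.
have h0 : h != 0 by rewrite gt_eqF.
split; [exact: elem_vankaE|exact: is_mass_stencil_fe|move=> u j].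
rewrite elem_vankaE// !stencil_op3 !rmorphM !fmorphV !rmorph1 !rmorph_nat.
ring.
Qed.
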